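(* Let $m\ge2$ and let $\{\xi_{j}\}_{j=0}^{m-2}$ be any $m-1$ distinct points in the open interval $(0,1)$. Suppose that $z_m\in{}^{\theta}W_{\rho}^{m}[0,1]$ is the exact solution of $$a_{2}(\xi)\,{}^{c}D^{\alpha}z(\xi)+a_{1}(\xi)\,{}^{c}D^{\beta}z(\xi)+a_{0}(\xi)z(\xi)=g(\xi,z(\xi),z'(\xi)),\qquad z(0)=z(\theta)=z(1)=0.$$ Then $$z_{m}(\xi)=\sum_{j=0}^{m-2}\sum_{k=0}^{j}\beta_{jk}^{m}\,g(\xi_{k},z_{m}(\xi_{k}),z_{m}'(\xi_{k}))\,\bar{\psi}_{j}^{m}(\xi).$$
   Context: Fix $0<\theta<1$, $1<\alpha\le 2$, $0<\beta\le 1$, sufficiently smooth functions $a_0,a_1,a_2\in C^2(0,1)$, and a sufficiently smooth real function $g(\xi,u,v)$ giving right-hand sides in $L^2_\rho[0,1]$. ${}^{\theta}W_{\rho}^{m}[0,1]$ is the space of real polynomials $z$ of degree at most $m$ on $[0,1]$ with $z(0)=z(\theta)=z(1)=0$, with inner product $\langle z,v\rangle_{{}^{\theta}W_{\rho}^{m}}=\int_0^1 z(\xi)v(\xi)\,d\xi$ (weight $\rho=1$), and $L_\rho^2[0,1]$ is the usual $L^2[0,1]$. ${}^{\theta}R_x^m(\xi)$ is the reproducing kernel of ${}^{\theta}W_{\rho}^{m}[0,1]$: ${}^{\theta}R_x^m\in{}^{\theta}W_{\rho}^{m}[0,1]$ and $\langle z,{}^{\theta}R_x^m\rangle_{{}^{\theta}W_{\rho}^{m}}=z(x)$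 for all $z\in{}^{\theta}W_{\rho}^{m}[0,1]$, $x\in[0,1]$. The Caputo derivative of order $\gamma$ with $k-1<\gamma<k$, $k\in\mathbb{N}$, is ${}^{c}D^{\gamma}z(\xi)=\frac{1}{\Gamma(k-\gamma)}\int_0^\xi(\xi-s)^{k-\gamma-1}z^{(k)}(s)\,ds$, and ${}^cD^{k}z=z^{(k)}$ for integer order. The operator $L:{}^{\theta}W_{\rho}^{m}[0,1]\to L_\rho^2[0,1]$, $Lz(\xi)=a_2(\xi)\,{}^{c}D^{\alpha}z(\xi)+a_1(\xi)\,{}^{c}D^{\beta}z(\xi)+a_0(\xi)z(\xi)$, is taken to be a bounded linear operator. The functions $\psi_j^m\in{}^{\theta}W_{\rho}^{m}[0,1]$ are $\psi_j^m(\xi)=L_x\,{}^{\theta}R_x^m(\xi)|_{x=\xi_j}$ ($L_x$: $L$ acting in the variable $x$), which the paper also writes as $L^{\ast}\,{}^{\theta}R_{\xi_j}^m(\xi)$. $\{\bar\psi_j^m\}_{j=0}^{m-2}$ is the orthonormal system of ${}^{\theta}W_{\rho}^{m}[0,1]$ derived from $\{\psi_j^m\}_{j=0}^{m-2}$ by Gram-Schmidt orthogonalization, $\bar\psi_j^m(\xi)=\sum_{k=0}^{j}\beta_{jk}^m\psi_k^m(\xi)$, with orthogonalization coefficients $\beta_{jk}^m$; it is taken to be a complete orthonormal system in ${}^{\theta}W_{\rho}^{m}[0,1]$.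
   Formalization: The space has dimension m-2, so the m-1 functions obtained by Gram-Schmidt cannot all be orthonormal; here Gram-Schmidt yields the zero function whenever a function depends linearly on its predecessors, and the resulting system is assumed complete. *)

(* Defs.v *)
From mathcomp Require Import all_boot all_order all_algebra.
From mathcomp Require Import all_classical all_reals all_analysis.

Set Implicit Arguments.
Unset Strict Implicit.
Unset Printing Implicit Defensive.

Import Order.TTheory GRing.Theory Num.Theory.
Import numFieldNormedType.Exports.

Local Open Scope classical_set_scope.
Local Open Scope ring_scope.

Definition Gamma (R : realType) (x : R) : R :=
  \int[@lebesgue_measure R]_(t in `]0, +oo[) (t `^ (x - 1) * expR (- t)).

(* k is the ceiling of gamma: gamma = k or k - 1 < gamma < k.  For 0 < xi < 1 the
   value depends only on z restricted to [0, 1]: the values of z elsewhere can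
   alter the integrand at s = 0 only. *)
Definition caputo (R : realType) (gamma : R) (z : R -> R) (xi : R) : R :=
  let k := `|Num.ceil gamma|%N in
  if gamma == k%:R then derive1n k z xi
  else (Gamma (k%:R - gamma))^-1 *
       \int[@lebesgue_measure R]_(s in `[0, xi])
          ((xi - s) `^ (k%:R - gamma - 1) * derive1n k z s).

Definition frac_op (R : realType) (a2 a1 a0 : R -> R) (alpha beta : R)
    (z : R -> R) (xi : R) : R :=
  a2 xi * caputo alpha z xi + a1 xi * caputo beta z xi + a0 xi * z xi.

Definition C2_unit (R : realType) (f : R -> R) : Prop :=
  forall x : R, 0 < x < 1 ->
    [/\ derivable f x 1, derivable (derive1 f) x 1
      & {for x, continuous (derive1n 2 f)}].

(* Polynomial functions on [0, 1] are identified with elements of {poly R}. *)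
Definition inW (R : realType) (theta : R) (m : nat) (z : {poly R}) : Prop :=
  [/\ (size z <= m.+1)%N, z.[0] = 0, z.[theta] = 0 & z.[1] = 0].

Definition W_inner (R : realType) (z v : {poly R}) : R :=
  \int[@lebesgue_measure R]_(x in `[0, 1]) (z.[x] * v.[x]).

Definition W_norm (R : realType) (z : {poly R}) : R := Num.sqrt (W_inner z z).

Definition inL2 (R : realType) (f : R -> R) : Prop :=
  (f \_ (`[0%R, 1%R]%classic : set R)) \in Lfun (@lebesgue_measure R) 2%:E.

Definition L2_norm (R : realType) (f : R -> R) : \bar R :=
  'N[@lebesgue_measure R]_2%:E [EFin \o (f \_ (`[0%R, 1%R]%classic : set R))]%E.

Definition bounded_linear_W_L2 (R : realType) (theta : R) (m : nat)
    (T : (R -> R) -> R -> R) : Prop :=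
  [/\ forall z, inW theta m z -> inL2 (T (horner z)),
      forall (c : R) z v, inW theta m z -> inW theta m v ->
        forall xi : R, 0 <= xi <= 1 ->
        T (horner (c *: z + v)) xi = c * T (horner z) xi + T (horner v) xi
    & exists C : R, forall z, inW theta m z ->
        (L2_norm (T (horner z)) <= (C * W_norm z)%:E)%E].

Definition reproducing_kernel (R : realType) (theta : R) (m : nat)
    (K : R -> {poly R}) : Prop :=
  forall x : R, 0 <= x <= 1 ->
    inW theta m (K x) /\
    forall z, inW theta m z -> W_inner z (K x) = z.[x].

(* e_0, ..., e_(n-1) arise from p_0, ..., p_(n-1) by Gram-Schmidt.  As 0^-1 = 0,
   e_j = 0 when p_j depends linearly on its predecessors, and the nonzero e_j
   are orthonormal.  This convention matters here: the m - 1 functions psi_j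
   live in a space of dimension at most m - 2, so at least one e_j vanishes. *)
Definition gram_schmidt (R : realType) (n : nat) (p e : nat -> {poly R}) : Prop :=
  forall j, (j < n)%N ->
    let r := p j - \sum_(0 <= i < j) W_inner (p j) (e i) *: e i in
    e j = (W_norm r)^-1 *: r.

Definition complete_system (R : realType) (theta : R) (m n : nat)
    (e : nat -> {poly R}) : Prop :=
  forall z, inW theta m z ->
    (forall j, (j < n)%N -> W_inner z (e j) = 0) -> z = 0.

(* Main.v *)
(* By symmetry of the kernel, psi_k(y) = L(K_y)(xi_k), and expanding in the
   complete system shows that psi_k represents the functional z |-> Lz(xi_k).
   Hence <z_m, psi_k> = L z_m(xi_k) = g(xi_k, z_m(xi_k), z_m'(xi_k)), and it
   remains to expand z_m in the orthonormal system.  Vanishing vectors of that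
   system drop out, so the psi_k need not be linearly independent. *)
Require Import Defs.
From mathcomp Require Import all_boot all_order all_algebra.
From mathcomp Require Import all_classical all_reals all_analysis.
From mathcomp Require Import measurable_realfun.
Set Implicit Arguments.
Unset Strict Implicit.
Unset Printing Implicit Defensive.
Import Order.TTheory GRing.Theory Num.Theory.
Import numFieldNormedType.Exports.
Local Open Scope classical_set_scope.
Local Open Scope ring_scope.

(** * Locality of the fractional operator *)

Section Locality.
Variable R : realType.
Implicit Types (f h : R -> R) (p : {poly R}).

(** An open interval is a neighbourhood of each of its points, so equality on all of it survives
    each differentiation; equality at a single point would not support the induction. *)
Lemma eq_derive1n_itvoo f h (a b : R) n :
  {in `]a, b[, f =1 h} -> {in `]a, b[, derive1n n f =1 derive1n n h}.
Proof.
move=> fh; elim: n => [//|n IHn] x xab.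
rewrite /= !derive1E; apply: near_eq_derive.
near=> y; apply: IHn.
by near: y; exact: near_in_itvoo.
Unshelve. all: by end_near. Qed.

Lemma derive1n_horner n p : derive1n n (horner p) = horner (p^`(n))%R.
Proof.
by elim: n => [//|n IHn]; rewrite derivnS derivE -IHn.
Qed.

Lemma measurable_horner p (D : set R) : measurable_fun D (horner p).
Proof.
apply: measurable_funTS; apply: continuous_measurable_fun.
exact: continuous_horner.
Qed.

(* At [s = 0] the derivatives of [f] may involve values outside [0, 1], so the
   integrands are only compared on [`]0, x]]. *)
Lemma eq_caputo_horner (gamma : R) f p (x : R) :
  {in `]0, 1[, f =1 horner p} -> 0 < x < 1 ->
  caputo gamma f x = caputo gamma (horner p) x.
Proof.
move=> fp /andP[x0 x1]; rewrite /caputo.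
have dfp := eq_derive1n_itvoo _ fp.
case: ifP => _; first by apply: dfp; rewrite in_itv /= x0 x1.
congr (_ * _); set k := `|_|%N; set e := _ - 1.
have eqI : {in (`]0, x]%classic : set R),
    (fun s => (x - s) `^ e * derive1n k f s) =1
    (fun s => (x - s) `^ e * derive1n k (horner p) s)}.
  move=> s; rewrite inE /= in_itv /= => /andP[s0 sx].
  (* The closed end [s = x] is harmless: [x < 1] keeps it inside []0, 1[]. *)
  by rewrite dfp // in_itv /= s0 (le_lt_trans sx).
have mp : measurable_fun (`]0, x]%classic : set R)
    (fun s => (x - s) `^ e * derive1n k (horner p) s).
  apply: measurable_funM.
    by apply: (measurableT_comp (measurable_powR e)); exact: measurable_funB.
  by rewrite derive1n_horner; exact: measurable_horner.
have mf : measurable_fun (`]0, x]%classic : set R)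
    (fun s => (x - s) `^ e * derive1n k f s).
  by apply: eq_measurable_fun mp => s sx; rewrite eqI.
(* The point 0 is null, so both integrals reduce to []0, x]]; measurability of the two integrands is
   used here. *)
rewrite /Rintegral -!integral_itv_obnd_cbnd; try exact/measurable_EFinP.
by congr fine; apply: eq_integral => s sx; rewrite eqI.
Qed.

(** Meant for the kernel sections [fun x => (K x).[y]], which are known to be polynomial on [0, 1]
    only. *)
Lemma eq_frac_op_horner (a2 a1 a0 : R -> R) (alpha beta : R) f p (x : R) :
  {in `]0, 1[, f =1 horner p} -> 0 < x < 1 ->
  frac_op a2 a1 a0 alpha beta f x = frac_op a2 a1 a0 alpha beta (horner p) x.
Proof.
by move=> fp x01; rewrite /frac_op !(eq_caputo_horner _ fp x01) fp.
Qed.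

End Locality.

(** * Bilinearity of the integral inner product *)

Section InnerProduct.
Variable R : realType.
Implicit Types (z v w : {poly R}) (c : R).

Lemma W_innerC z v : W_inner z v = W_inner v z.
Proof. by apply: eq_Rintegral => x _; rewrite mulrC. Qed.

Lemma eq_W_innerl z v w :
  (forall y, 0 <= y <= 1 -> z.[y] = v.[y]) -> W_inner z w = W_inner v w.
Proof.
move=> zv; apply: eq_Rintegral => x.
by rewrite inE /= in_itv /= => /zv ->.
Qed.

Lemma integrable_hornerM z v :
  (@lebesgue_measure R).-integrable `[0%R, 1%R]
    (EFin \o (fun x => z.[x] * v.[x])).
Proof.
apply: continuous_compact_integrable; first exact: segment_compact.
apply: continuous_subspaceT => x.
by apply: continuousM; exact: continuous_horner.
Qed.

Lemma W_inner_linearl c z v w :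
  W_inner (c *: z + v) w = c * W_inner z w + W_inner v w.
Proof.
rewrite /W_inner -RintegralZl //; last exact: integrable_hornerM.
rewrite -RintegralD //; last exact: integrable_hornerM.
  by apply: eq_Rintegral => x _; rewrite hornerD hornerZ mulrDl mulrA.
have := integrable_hornerM (c *: z) w.
by under [X in EFin \o X]eq_fun do rewrite hornerZ -mulrA.
Qed.

Lemma W_inner0l w : W_inner 0 w = 0.
Proof.
have := W_inner_linearl 1 0 0 w.
by rewrite scale1r addr0 mul1r => /esym/(canRL (addrK _)); rewrite subrr.
Qed.

Lemma W_innerZl c z w : W_inner (c *: z) w = c * W_inner z w.
Proof. by rewrite -[c *: z]addr0 W_inner_linearl W_inner0l addr0. Qed.

Lemma W_innerDl z v w : W_inner (z + v) w = W_inner z w + W_inner v w.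
Proof. by rewrite -[z in LHS]scale1r W_inner_linearl mul1r. Qed.

Lemma W_innerBl z v w : W_inner (z - v) w = W_inner z w - W_inner v w.
Proof. by rewrite W_innerDl -scaleN1r W_innerZl mulN1r. Qed.

Lemma W_inner_suml n (c : nat -> R) (e : nat -> {poly R}) w :
  W_inner (\sum_(0 <= i < n) c i *: e i) w =
  \sum_(0 <= i < n) c i * W_inner (e i) w.
Proof.
rewrite (big_morph (fun z => W_inner z w)
  (fun z v => W_innerDl z v w) (W_inner0l w)).
by apply: eq_bigr => i _; rewrite W_innerZl.
Qed.

End InnerProduct.

(** * Linear combinations in the polynomial space *)

Section PolynomialSpace.
Variables (R : realType) (theta : R) (m : nat).

Lemma inW0 : inW theta m 0.
Proof. by split; rewrite ?horner0 // size_poly0. Qed.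

Lemma inW_linear (c : R) z v :
  inW theta m z -> inW theta m v -> inW theta m (c *: z + v).
Proof.
move=> [sz z0 zt z1] [sv v0 vt v1]; split; rewrite ?hornerD ?hornerZ.
- rewrite (leq_trans (size_polyD _ _)) // geq_max sv andbT.
  exact: leq_trans (size_scale_leq _ _) sz.
- by rewrite z0 v0 mulr0 addr0.
- by rewrite zt vt mulr0 addr0.
- by rewrite z1 v1 mulr0 addr0.
Qed.

Lemma inW_sum n (c : nat -> R) (e : nat -> {poly R}) :
  (forall i, (i < n)%N -> inW theta m (e i)) ->
  inW theta m (\sum_(0 <= i < n) c i *: e i).
Proof.
elim: n => [|n IHn] eW; first by rewrite big_nil; exact: inW0.
rewrite big_nat_recr //= addrC; apply: inW_linear; first exact: eW.
by apply: IHn => i /ltnW; apply: eW.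
Qed.

(** Since [l] is linear on the space only, membership accompanies the induction, and [l 0 = 0] comes
    from [l 0 = l 0 + l 0]. *)
Lemma linear_on_W_sum (l : {poly R} -> R) n (c : nat -> R) e :
  (forall (a : R) z v, inW theta m z -> inW theta m v ->
     l (a *: z + v) = a * l z + l v) ->
  (forall i, (i < n)%N -> inW theta m (e i)) ->
  l (\sum_(0 <= i < n) c i *: e i) = \sum_(0 <= i < n) c i * l (e i).
Proof.
move=> llin; elim: n => [|n IHn] eW.
  have := llin 1 0 0 inW0 inW0; rewrite !big_nil scale1r addr0 mul1r.
  by move=> /esym/(canRL (addrK _)); rewrite subrr.
have eW' i : (i < n)%N -> inW theta m (e i) by move=> /ltnW; exact: eW.
rewrite !big_nat_recr //= addrC llin; [|exact: eW|exact: inW_sum].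
by rewrite IHn // addrC.
Qed.

End PolynomialSpace.

(** * Gram-Schmidt systems with possibly vanishing vectors *)

Section GramSchmidt.
Variables (R : realType) (n : nat) (p e : nat -> {poly R}).
Hypothesis egs : gram_schmidt n p e.

Lemma gram_schmidt_norm j :
  (j < n)%N -> W_inner (e j) (e j) = 1 \/ e j = 0.
Proof.
move=> /egs /=; set r := p j - _ => ->.
have [->|r0] := eqVneq (W_norm r) 0; first by right; rewrite invr0 scale0r.
left; rewrite W_innerZl W_innerC W_innerZl.
(* A nonzero square root forces a positive radicand, so the norm squares back to [W_inner r r]. *)
have rr : 0 < W_inner r r by rewrite -sqrtr_gt0 lt_def r0 sqrtr_ge0.
by rewrite -(sqr_sqrtr (ltW rr)) -/(W_norm r) expr2 mulKf // mulVf.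
Qed.

(** Lets unit and zero vectors be handled alike: the squared norm is either 1, or 0 together with
    the coefficient. *)
Lemma gram_schmidt_proj z i :
  (i < n)%N -> W_inner z (e i) * W_inner (e i) (e i) = W_inner z (e i).
Proof.
move=> /gram_schmidt_norm[->|->]; first by rewrite mulr1.
by rewrite W_inner0l mulr0 W_innerC W_inner0l.
Qed.

(** Strong induction on the larger index: pairing the residue of [p j] with [e i] kills all
    projections but the one along [e i], which cancels [W_inner (p j) (e i)]. *)
Lemma gram_schmidt_orthogonal i j :
  (i < j)%N -> (j < n)%N -> W_inner (e j) (e i) = 0.
Proof.
elim/ltn_ind: j i => j IHj i ij jn.
rewrite [e j]egs //= W_innerZl; set c := (W_norm _)^-1.
rewrite W_innerBl W_inner_suml.
rewrite (bigD1_seq i) ?mem_index_iota ?iota_uniq //=.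
rewrite big1_seq; last first.
  move=> l /andP[li]; rewrite mem_index_iota /= => lj.
  (* The induction hypothesis applies at the larger of [l] and [i], both below [j]; symmetry covers
     [l < i]. *)
  have [lti|gti|eqi] := ltngtP l i; last by rewrite eqi eqxx in li.
    by rewrite (W_innerC (e l)) (IHj i) ?mulr0 // (ltn_trans ij).
  by rewrite (IHj l) ?mulr0 // (ltn_trans lj).
by rewrite addr0 gram_schmidt_proj ?(ltn_trans ij) // subrr mulr0.
Qed.

(** The difference of the two sides lies in the space and is orthogonal to every [e i], so
    completeness makes it zero. *)
Lemma gram_schmidt_expansion (theta : R) (m : nat) z :
  complete_system theta m n e ->
  (forall j, (j < n)%N -> inW theta m (e j)) -> inW theta m z ->
  z = \sum_(0 <= j < n) W_inner z (e j) *: e j.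
Proof.
move=> ecomp eW zW; apply/eqP; rewrite -subr_eq0; apply/eqP/ecomp.
  rewrite addrC -scaleN1r; apply: inW_linear => //; exact: inW_sum.
move=> i ilt; rewrite W_innerBl W_inner_suml.
rewrite (bigD1_seq i) ?mem_index_iota ?iota_uniq //=.
rewrite big1_seq; last first.
  move=> l /andP[li]; rewrite mem_index_iota /= => ln.
  have [lti|gti|eqi] := ltngtP l i; last by rewrite eqi eqxx in li.
    by rewrite (W_innerC (e l)) gram_schmidt_orthogonal ?mulr0.
  by rewrite gram_schmidt_orthogonal ?mulr0.
by rewrite addr0 gram_schmidt_proj // subrr.
Qed.

End GramSchmidt.

(** * Representation by the kernel and the solution formula *)

Lemma reproducing_kernel_sym (R : realType) (theta : R) m K x y :
  reproducing_kernel theta m K -> 0 <= x <= 1 -> 0 <= y <= 1 ->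
  (K x).[y] = (K y).[x].
Proof.
move=> Krep x01 y01; have [KxW Kx] := Krep _ x01; have [KyW Ky] := Krep _ y01.
(* Both values equal the inner product of [K x] and [K y]. *)
by rewrite -Ky // W_innerC Kx.
Qed.

(* Expanding [K y] in the complete system gives
   [v.[y] = \sum_j (e j).[y] * l (e j)], the Riesz representer of [l]. *)
Lemma riesz_kernel (R : realType) (theta : R) m n p e K l v z :
  reproducing_kernel theta m K -> gram_schmidt n p e ->
  complete_system theta m n e -> (forall j, (j < n)%N -> inW theta m (e j)) ->
  (forall (a : R) z1 z2, inW theta m z1 -> inW theta m z2 ->
     l (a *: z1 + z2) = a * l z1 + l z2) ->
  (forall y, 0 <= y <= 1 -> v.[y] = l (K y)) ->
  inW theta m z -> W_inner z v = l z.
Proof.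
move=> Krep egs ecomp eW llin vK zW.
rewrite W_innerC (@eq_W_innerl _ _ (\sum_(0 <= j < n) l (e j) *: e j)).
  rewrite W_inner_suml.
  rewrite [in RHS](gram_schmidt_expansion egs ecomp eW zW).
  rewrite (linear_on_W_sum _ llin eW); apply: eq_bigr => j _.
  by rewrite mulrC W_innerC.
move=> y y01; have [KyW Ky] := Krep _ y01.
rewrite vK // (gram_schmidt_expansion egs ecomp eW KyW).
rewrite (linear_on_W_sum _ llin eW) horner_sum; apply: eq_big_nat => j jn.
by rewrite hornerZ W_innerC (Ky _ (eW _ jn)) mulrC.
Qed.

Theorem theorem3p4 (R : realType) (theta alpha beta : R) (a0 a1 a2 : R -> R)
  (g : R -> R -> R -> R) (m : nat) (K : R -> {poly R})
  (xi : nat -> R) (psi bpsi : nat -> {poly R}) (B : nat -> nat -> R)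
  (zm : {poly R})
  (htheta : 0 < theta < 1) (halpha : 1 < alpha <= 2) (hbeta : 0 < beta <= 1)
  (ha0 : C2_unit a0) (ha1 : C2_unit a1) (ha2 : C2_unit a2)
  (hg : forall x u v : R, 0 < x < 1 ->
     {for (x, u, v), continuous (fun p : R * R * R => g p.1.1 p.1.2 p.2)})
  (hg2 : forall z, inW theta m z ->
     inL2 (fun x => g x z.[x] (z^`()%R).[x]))
  (hm : (2 <= m)%N)
  (hL : bounded_linear_W_L2 theta m (frac_op a2 a1 a0 alpha beta))
  (hK : reproducing_kernel theta m K)
  (hxi : forall j, (j < m.-1)%N -> 0 < xi j < 1)
  (hxi_inj : forall i j, (i < m.-1)%N -> (j < m.-1)%N -> xi i = xi j -> i = j)
  (hpsi : forall j, (j < m.-1)%N ->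
     inW theta m (psi j) /\
     forall y : R, 0 <= y <= 1 ->
       (psi j).[y] = frac_op a2 a1 a0 alpha beta (fun x => (K x).[y]) (xi j))
  (hbpsi : gram_schmidt m.-1 psi bpsi)
  (hB : forall j, (j < m.-1)%N ->
     bpsi j = \sum_(0 <= k < j.+1) B j k *: psi k)
  (hcomplete : complete_system theta m m.-1 bpsi)
  (hzm : inW theta m zm)
  (hsol : forall x : R, 0 < x < 1 ->
     frac_op a2 a1 a0 alpha beta (horner zm) x = g x zm.[x] (zm^`()%R).[x]) :
  forall y : R, 0 <= y <= 1 ->
    zm.[y] = \sum_(0 <= j < m.-1) \sum_(0 <= k < j.+1)
       B j k * g (xi k) zm.[xi k] (zm^`()%R).[xi k] * (bpsi j).[y].
Proof.
have eW j : (j < m.-1)%N -> inW theta m (bpsi j).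
  move=> jm; rewrite hB //; apply: inW_sum => k kj.
  by have [] := hpsi _ (leq_trans kj jm).
have psiE k : (k < m.-1)%N ->
    W_inner zm (psi k) = g (xi k) zm.[xi k] (zm^`()%R).[xi k].
  move=> km; have xik := hxi _ km; rewrite -hsol //.
  have xik' : 0 <= xi k <= 1 by case/andP: xik => /ltW -> /ltW ->.
  apply: (@riesz_kernel _ theta m _ _ _ _
    (fun z => frac_op a2 a1 a0 alpha beta (horner z) (xi k))
    _ _ hK hbpsi hcomplete eW) => //.
    by case: hL => _ lin _ a z1 z2 z1W z2W; exact: lin.
  move=> y y01; have [_ ->] := hpsi _ km; rewrite //.
  (* Kernel symmetry is available for [x] in [0, 1] only; by locality, agreement with [K y] on the
     open interval is enough. *)
  apply: eq_frac_op_horner => // x; rewrite in_itv /= => /andP[/ltW x0 /ltW x1].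
  by rewrite (reproducing_kernel_sym hK) // x0.
move=> y _; rewrite {1}(gram_schmidt_expansion hbpsi hcomplete eW hzm).
rewrite horner_sum; apply: eq_big_nat => j /andP[_ jm].
(* [hB] unfolds every [bpsi j]; once the sum has left the coefficient, [-hB] restores those
   evaluated at [y]. *)
rewrite hornerZ hB // W_innerC W_inner_suml -hB // mulr_suml.
apply: eq_big_nat => k /andP[_ kj].
by rewrite W_innerC psiE // (leq_trans kj).
Qed.
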